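(* (i) Given a separable $PA(n,d)$ which is the disjoint union of $r$ $PA(n,\delta)$'s, each of size $N$, where $2d \geq \delta$, there exists an $FPA_2(2n,\delta)$ of size $rN^2$. (ii) Given $r$ mutually orthogonal latin squares (MOLS) of order $n$, there exists an $FPA_2(2n,n)$ of size $rn^2$. If $n$ is a prime power, there exists an $FPA_2(2n,n)$ of size $(n-1)n^2$.
   Context: A $\lambda$-permutation of length $n$ (where the positive integer $\lambda$ divides $n$) is an arrangement (sequence of length $n$) of the multiset consisting of $n/\lambda$ distinct symbols, each repeated exactly $\lambda$ times. The distance between two $\lambda$-permutations is the Hamming distance, i.e. the number of positions in which they disagree. A frequency permutation array $FPA_\lambda(n,d)$ is a set $T$ of $\lambda$-permutations of length $n$ (on a common set of $n/\lambda$ symbols) such that any two distinct members of $T$ have distance at least $d$; its size is $|T|$. When $\lambda=1$, it is called a permutation array $PA(n,d)$: a set of permutations of $n$ symbols (written in image form) with pairwise Hamming distance at least $d$. A permutation array is called separable if it is a disjoint union of other permutation arrays. A latin square of order $n$ is an $n\times n$ array in which $n$ distinct symbols (from a fixed $n$-element set) are arranged so that each symbol occurs once in each row and column. Two latin squares of the same order $n$ are orthogonal if, when superimposed, each of the possible $n^2$ ordered pairs occurs exactly once. A set of latin squares is mutually orthogonal (a set of MOLS) if its distinct members are pairwise orthogonal. *)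

(* Defs.v *)
From mathcomp Require Import all_boot all_algebra.

Set Implicit Arguments.
Unset Strict Implicit.
Unset Printing Implicit Defensive.

(* A sequence in which each symbol of S occurs exactly lam times. *)
Definition is_freq_perm (S : finType) (lam n : nat) (w : n.-tuple S) : Prop :=
  forall s : S, count_mem s w = lam.

Definition hamming (S : finType) (n : nat) (u v : n.-tuple S) : nat :=
  #|[set i : 'I_n | tnth u i != tnth v i]|.

(* T is an FPA_lam(n, d) on the symbol set S. *)
Definition is_FPA (S : finType) (lam n d : nat) (T : {set n.-tuple S}) : Prop :=
  [/\ 0 < lam,
      lam %| n,
      #|S| = n %/ lam,
      forall w, w \in T -> is_freq_perm lam w
    & forall u v, u \in T -> v \in T -> u != v -> d <= hamming u v].

Definition is_PA (S : finType) (n d : nat) (T : {set n.-tuple S}) : Prop :=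
  is_FPA 1 d T.

Definition FPA_exists (lam n d m : nat) : Prop :=
  exists (S : finType) (T : {set n.-tuple S}), is_FPA lam d T /\ #|T| = m.

Definition is_disjoint_union (X : finType) (r : nat)
    (P : {set X}) (B : 'I_r -> {set X}) : Prop :=
  P = \bigcup_(i < r) B i /\ (forall i j, i != j -> [disjoint B i & B j]).

Definition is_latin_square (S : finType) (n : nat) (L : 'M[S]_n) : Prop :=
  [/\ #|S| = n,
      forall (i : 'I_n) (s : S), #|[set j | L i j == s]| = 1
    & forall (j : 'I_n) (s : S), #|[set i | L i j == s]| = 1].

Definition orthogonal_squares (S : finType) (n : nat) (L M : 'M[S]_n) : Prop :=
  forall s t : S,
    #|[set ij : 'I_n * 'I_n | (L ij.1 ij.2 == s) && (M ij.1 ij.2 == t)]| = 1.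

(* A set, not an indexed family: for n <= 1 a latin square is orthogonal to
   itself, so repetitions must be excluded for its size to be meaningful. *)
Definition is_MOLS (S : finType) (n : nat) (Q : {set 'M[S]_n}) : Prop :=
  (forall L, L \in Q -> is_latin_square L) /\
  (forall L M, L \in Q -> M \in Q -> L != M -> orthogonal_squares L M).

Definition is_prime_power (n : nat) : Prop :=
  exists p k : nat, [/\ prime p, 0 < k & n = p ^ k].

(* Main.v *)
Require Import Defs.
From mathcomp Require Import all_boot all_algebra all_field zify ring.

Set Implicit Arguments.
Unset Strict Implicit.
Unset Printing Implicit Defensive.

(** Concatenating two permutations of [n] symbols gives a 2-permutation of
    length [2n], and Hamming distances add.  All pairs taken inside one class
    of the disjoint union give the array of (i): two pairs from the same class
    differ in a component, which contributes [delta], and two pairs from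
    different classes differ in both components, which contributes [d] twice.

    For (ii), a latin square [L] and a symbol [s] determine the permutation
    sending a row [i] to the column [j] with [L i j = s].  Permutations of the
    same square disagree everywhere, and those of two orthogonal squares agree
    exactly once.  Over a finite field the squares [a x + y], [a <> 0], are
    mutually orthogonal. *)

Import GRing.Theory.

Lemma hamming_sum (S : finType) (n : nat) (u v : n.-tuple S) :
  hamming u v = \sum_(i < n) (tnth u i != tnth v i).
Proof.
rewrite /hamming -sum1_card [LHS]big_mkcond; apply: eq_bigr => i _.
by rewrite inE; case: eqP.
Qed.

Lemma hamming_cat (S : finType) (m n : nat)
    (u u' : m.-tuple S) (v v' : n.-tuple S) :
  hamming (cat_tuple u v) (cat_tuple u' v') = hamming u u' + hamming v v'.
Proof.
rewrite !hamming_sum big_split_ord.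
by congr (_ + _); apply: eq_bigr => i _; rewrite ?tnth_lshift ?tnth_rshift.
Qed.

Lemma hammingxx (S : finType) (n : nat) (u : n.-tuple S) : hamming u u = 0.
Proof. by rewrite hamming_sum big1 // => i _; rewrite eqxx. Qed.

Lemma cat_tuple_inj (S : finType) (m n : nat) :
  injective (fun x : m.-tuple S * n.-tuple S => cat_tuple x.1 x.2).
Proof.
move=> [u v] [u' v'] /(congr1 val) /= /eqP.
rewrite eqseq_cat ?size_tuple // => /andP[/eqP uu' /eqP vv'].
by congr (_, _); apply: val_inj.
Qed.

(** Common core of (i) and (ii). The cross-class condition is doubled because two such distances get
    added; it then covers both [d] with [delta <= 2 * d] and the distance [n - 1] coming from
    orthogonal squares. *)
Lemma FPA2_of_classes (S I : finType) (n delta N : nat)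
    (B : I -> {set n.-tuple S}) :
  #|S| = n ->
  (forall i w, w \in B i -> is_freq_perm 1 w) ->
  (forall i u v, u \in B i -> v \in B i -> u != v -> delta <= hamming u v) ->
  (forall i, #|B i| = N) ->
  (forall i j, i != j -> [disjoint B i & B j]) ->
  (forall i j u v, i != j -> u \in B i -> v \in B j ->
     delta <= 2 * hamming u v) ->
  FPA_exists 2 (2 * n) delta (#|I| * N ^ 2).
Proof.
move=> cardS freqB distB cardB disjB crossB.
have dvd2 : 2 %| n + n by rewrite addnn -mul2n dvdn_mulr.
have half : #|S| = (n + n) %/ 2 by rewrite cardS addnn -mul2n mulKn.
rewrite mul2n -addnn.
pose catp (x : n.-tuple S * n.-tuple S) := cat_tuple x.1 x.2.
pose T := \bigcup_(i : I) setX (B i) (B i).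
exists S, (catp @: T); split; last first.
  rewrite card_imset; last exact: cat_tuple_inj.
  rewrite -sum1_card partition_disjoint_bigcup /=; last first.
    move=> i j /disjB; rewrite -!setI_eq0 => /eqP Bij0.
    apply/eqP/setP => -[u v]; rewrite !inE /=.
    have := in_set0 u; rewrite -Bij0 inE.
    by case: (u \in B i); case: (u \in B j); rewrite ?andbF.
  transitivity (\sum_(i : I) N ^ 2); last by rewrite sum_nat_const.
  by apply: eq_bigr => i _; rewrite sum1_card cardsX cardB -mulnn.
split=> //.
  move=> _ /imsetP[[u v] /bigcupP[i _ /setXP[/= uB vB]] ->] s /=.
  by rewrite count_cat (freqB i _ uB) (freqB i _ vB).
move=> _ w /imsetP[[u v] /bigcupP[i _ /setXP[/= uB vB]] ->].
move=> /imsetP[[u' v'] /bigcupP[j _ /setXP[/= uB' vB']] ->] neq.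
(* For different classes, each half contributes at least half of [delta]. *)
rewrite hamming_cat /=; have [ij|nij] := eqVneq i j; last first.
  have := crossB _ _ _ _ nij uB uB'; have := crossB _ _ _ _ nij vB vB'; lia.
rewrite -{j}ij in uB' vB'.
have [uu'|/(distB i _ _ uB uB') le] := eqVneq u u'; last first.
  exact: leq_trans le (leq_addr _ _).
apply: leq_trans (leq_addl _ _); apply: distB vB vB' _.
by apply: contraNneq neq => vv'; rewrite uu' vv'.
Qed.

Lemma card_set1_ex (T : finType) (P : pred T) :
  #|[set x | P x]| = 1 -> exists x, P =1 pred1 x.
Proof.
move/eqP/cards1P => [x Px]; exists x => y.
by have := in_set1 y x; rewrite -Px inE.
Qed.

(** The default [i] only makes the function total; in a latin square the row condition ensures that
    [pick] succeeds. *)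
Definition symbol_perm (S : finType) (n : nat) (L : 'M[S]_n) (s : S) :
    n.-tuple 'I_n :=
  [tuple odflt i [pick j | L i j == s] | i < n].

Lemma symbol_permE (S : finType) (n : nat) (L : 'M[S]_n) (s : S) (i j : 'I_n) :
  is_latin_square L -> (tnth (symbol_perm L s) i == j) = (L i j == s).
Proof.
case=> _ /(_ i s) /card_set1_ex[k Lk] _; rewrite tnth_mktuple Lk /=.
case: pickP => [j'|/(_ k)]; rewrite Lk /= ?eqxx // => /eqP ->.
exact: eq_sym.
Qed.

(** The value [j] is taken once because [s] occurs once in column [j]. *)
Lemma symbol_perm_freq (S : finType) (n : nat) (L : 'M[S]_n) (s : S) :
  is_latin_square L -> is_freq_perm 1 (symbol_perm L s).
Proof.
move=> latL j; have [_ _ /(_ j s) <-] := latL.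
rewrite -(map_tnth_enum (symbol_perm L s)) count_map -size_filter.
rewrite cardE /enum_mem -enumT -filter_predI; congr size; apply: eq_filter => i /=.
by rewrite [RHS]inE andbT; apply: symbol_permE.
Qed.

Lemma hamming_symbol_perm (S : finType) (n : nat) (L : 'M[S]_n) (s t : S) :
  is_latin_square L -> s != t ->
  hamming (symbol_perm L s) (symbol_perm L t) = n.
Proof.
move=> latL st; rewrite -[RHS]card_ord -cardsT; apply: eq_card => i.
rewrite !inE symbol_permE //; apply: contraNneq st => <-.
by rewrite -symbol_permE.
Qed.

(** An agreement at row [i] gives a cell holding [s] in [L] and [t] in [M]. There is only one such
    cell, so only its row [i0] can be an agreement. *)
Lemma hamming_orthogonal (S : finType) (n : nat) (L M : 'M[S]_n) (s t : S) :
  is_latin_square L -> is_latin_square M -> orthogonal_squares L M ->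
  n <= (hamming (symbol_perm L s) (symbol_perm M t)).+1.
Proof.
move=> latL latM /(_ s t) /card_set1_ex[[i0 j0] LM].
rewrite -[leqLHS]card_ord -cardsT (cardsD1 i0) inE add1n ltnS.
apply/subset_leq_card/subsetP => i; rewrite !inE andbT.
apply: contraNN => /eqP agree.
set j := tnth (symbol_perm L s) i.
have := LM (i, j); rewrite /= -!symbol_permE // -agree eqxx.
by move/esym/eqP => [-> _].
Qed.

Lemma FPA2_of_MOLS (S : finType) (n : nat) (Q : {set 'M[S]_n}) :
  is_MOLS Q -> FPA_exists 2 (2 * n) n (#|Q| * n ^ 2).
Proof.
move=> [latQ orthQ].
have latQi (i : 'I_#|Q|) : is_latin_square (enum_val i).
  by apply: latQ; apply: enum_valP.
(* With at most one symbol all squares coincide, so two distinct squares force [1 < n]. This gives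
   [n <= 2 * (n - 1)] and makes the distance [n - 1] positive. *)
have n_gt1 (i j : 'I_#|Q|) : i != j -> 1 < n.
  apply: contraNltn => n1; apply/eqP/enum_val_inj.
  have [cardS _ _] := latQi i.
  have /card_le1_eqP S1 : #|S| <= 1 by rewrite cardS.
  by apply/matrixP => x y; apply: S1.
have cross (i j : 'I_#|Q|) s t : i != j ->
    n <= (hamming (symbol_perm (enum_val i) s) (symbol_perm (enum_val j) t)).+1.
  move=> ij; apply: hamming_orthogonal => //; apply: orthQ; try exact: enum_valP.
  by apply: contraNneq ij => /enum_val_inj ->.
rewrite -[#|Q|]card_ord.
apply: (@FPA2_of_classes _ _ _ _ _
  (fun i : 'I_#|Q| => symbol_perm (enum_val i) @: [set: S])).
- exact: card_ord.
- by move=> i _ /imsetP[s _ ->]; apply: symbol_perm_freq.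
- move=> i _ w /imsetP[s _ ->] /imsetP[t _ ->] neq.
  by rewrite hamming_symbol_perm //; apply: contraNneq neq => ->.
- move=> i; have [cardS _ _] := latQi i.
  rewrite card_imset ?cardsT // => s t st; apply/eqP/negPn/negP => neq.
  (* Equal permutations for distinct symbols would give [n = 0], but [s] inhabits [S]. *)
  have := hamming_symbol_perm (latQi i) neq; rewrite st hammingxx => n0.
  by have := max_card (pred1 s); rewrite card1 cardS -n0.
- move=> i j ij; rewrite disjoints_subset; apply/subsetP => _ /imsetP[s _ ->].
  rewrite inE; apply/negP => /imsetP[t _ st].
  by have := cross _ _ s t ij; rewrite st hammingxx leqNgt (n_gt1 _ _ ij).
- move=> i j _ w ij /imsetP[s _ ->] /imsetP[t _ ->].
  have := cross _ _ s t ij; have := n_gt1 _ _ ij; lia.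
Qed.

Section FieldSquares.

Local Open Scope ring_scope.

Definition field_square (F : finFieldType) (a : F) : 'M[F]_#|F| :=
  \matrix_(i, j) (a * enum_val i + enum_val j).

Lemma field_square_inj (F : finFieldType) : injective (@field_square F).
Proof.
move=> a b /matrixP /(_ (enum_rank 1) (enum_rank 0)).
by rewrite !mxE !enum_rankK !mulr1 !addr0.
Qed.

Lemma card_enum_val_eq (F : finType) (P : pred 'I_#|F|) (x : F) :
  (forall i, P i = (enum_val i == x)) -> #|[set i | P i]| = 1%N.
Proof.
move=> PE; rewrite -(cards1 (enum_rank x)); apply: eq_card => i.
by rewrite !inE PE -(can_eq enum_valK) enum_rankK.
Qed.

(** The equation [a * x + y = s] is uniquely solvable in [y], and in [x] since [a] is invertible. *)
Lemma field_square_latin (F : finFieldType) (a : F) :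
  a != 0 -> is_latin_square (field_square a).
Proof.
move=> a0; split=> // [i s|j s].
  apply: (@card_enum_val_eq _ _ (s - a * enum_val i)) => j.
  by rewrite mxE addrC -subr_eq opprK.
apply: (@card_enum_val_eq _ _ ((s - enum_val j) / a)) => i.
rewrite mxE -[RHS](inj_eq (mulfI a0)) mulrCA mulfV // mulr1.
by rewrite [RHS]eq_sym subr_eq eq_sym.
Qed.

Lemma field_square_orthogonal (F : finFieldType) (a b : F) :
  a != b -> orthogonal_squares (field_square a) (field_square b).
Proof.
move=> ab s t; have ab0 : a - b != 0 by rewrite subr_eq0.
(* Cramer solution of [a * x + y = s], [b * x + y = t], whose determinant is [a - b]. *)
pose x := (s - t) / (a - b); pose y := s - a * x.
rewrite -(cards1 (enum_rank x, enum_rank y)); apply: eq_card => -[i j].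
rewrite !inE !mxE /= xpair_eqE -!(can_eq enum_valK) !enum_rankK.
set u := enum_val i; set v := enum_val j.
apply/andP/andP => -[/eqP Es /eqP Et]; last first.
  by rewrite Es Et /y /x; split; apply/eqP; field.
have ux : u = x by rewrite /x -Es -Et; field.
by rewrite /y -ux -Es eqxx addrC addKr.
Qed.

End FieldSquares.

Lemma FPA2_of_finField (F : finFieldType) :
  FPA_exists 2 (2 * #|F|) #|F| ((#|F| - 1) * #|F| ^ 2).
Proof.
have -> : #|F| - 1 = #|@field_square F @: [set~ 0%R]|.
  by rewrite card_imset ?cardsC1 ?subn1 //; apply: field_square_inj.
apply: FPA2_of_MOLS; split.
  by move=> _ /imsetP[a a0 ->]; apply: field_square_latin; rewrite !inE in a0.
move=> _ M /imsetP[a _ ->] /imsetP[b _ ->] ab.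
by apply: field_square_orthogonal; apply: contraNneq ab => ->.
Qed.

Theorem theorem4p6 :
  (forall (S : finType) (n d delta r N : nat)
      (P : {set n.-tuple S}) (B : 'I_r -> {set n.-tuple S}),
    is_PA d P ->
    is_disjoint_union P B ->
    (forall i : 'I_r, is_PA delta (B i) /\ #|B i| = N) ->
    delta <= 2 * d ->
    FPA_exists 2 (2 * n) delta (r * N ^ 2))
  /\
  (forall (S : finType) (n r : nat) (Q : {set 'M[S]_n}),
    is_MOLS Q -> #|Q| = r ->
    FPA_exists 2 (2 * n) n (r * n ^ 2))
  /\
  (forall n : nat,
    is_prime_power n ->
    FPA_exists 2 (2 * n) n ((n - 1) * n ^ 2)).
Proof.
split; last split.
- move=> S n d delta r N P B [_ _ cardS _ distP] [PE disjB] BP dd.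
  have subP (i : 'I_r) u : u \in B i -> u \in P.
    by move=> uB; rewrite PE; apply/bigcupP; exists i.
  rewrite -[r]card_ord; apply: (@FPA2_of_classes _ _ _ _ _ B) => //.
  + by rewrite cardS divn1.
  + by move=> i; have [[]] := BP i.
  + by move=> i; have [[]] := BP i.
  + by move=> i; have [] := BP i.
  (* Disjointness makes [u] and [v] distinct members of [P], hence at distance at least [d]. *)
  + move=> i j u v ij uB vB; apply: leq_trans dd _; rewrite leq_mul2l /=.
    apply: distP; [exact: subP uB | exact: subP vB |].
    by apply: contraTneq uB => ->; rewrite (disjointFl (disjB _ _ ij) vB).
- by move=> S n r Q molsQ <-; apply: FPA2_of_MOLS.
- move=> n [p [k [p_prime k_gt0 ->]]].
  by have [F _ <-] := PrimePowerField p_prime k_gt0; apply: FPA2_of_finField.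
Qed.
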